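(* Let $\kappa_1 \geq \cdots \geq \kappa_n$ be nonnegative integers with $\kappa_1=2$. Then the partition polytope $\mathrm{PP}(\kappa_1, \ldots, \kappa_n)$ has combinatorial diameter at most $3$.
   Context: For nonnegative integers $\kappa_1,\dots,\kappa_n$ with $m = \kappa_1+\cdots+\kappa_n$, the partition polytope $\mathrm{PP}(\kappa_1,\dots,\kappa_n)\subseteq\mathbb{R}^{nm}$ is the set of all real $n\times m$ matrices $(y_{ij})$ satisfying $\sum_{j=1}^m y_{ij}=\kappa_i$ for all $1\le i\le n$, $\sum_{i=1}^n y_{ij}=1$ for all $1\le j\le m$, and $y_{ij}\ge 0$ for all $i,j$. The (combinatorial) diameter of a polytope is the diameter of its edge graph, i.e. the graph whose vertices are the vertices of the polytope and whose edges are the one-dimensional faces of the polytope; the diameter of a connected graph is the maximum, over all pairs of vertices, of the length of a shortest path between them. *)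

(* Defs.v *)
From HB Require Import structures.
From mathcomp Require Import all_boot all_order all_algebra.
From mathcomp Require Import classical_sets reals.

Set Implicit Arguments.
Unset Strict Implicit.
Unset Printing Implicit Defensive.

Import Order.TTheory GRing.Theory Num.Theory.
Local Open Scope classical_set_scope.
Local Open Scope ring_scope.

Definition walk (V : Type) (e : V -> V -> Prop) (k : nat) (v w : V) : Prop :=
  exists u : nat -> V,
    [/\ u 0%N = v, u k = w & forall i, (i < k)%N -> e (u i) (u i.+1)].

Definition graph_dist (V : Type) (e : V -> V -> Prop) (v w : V) (d : nat) : Prop :=
  walk e d v w /\ forall k, walk e k v w -> (d <= k)%N.

(* The graph with vertex set [S] and edge relation [e] is connected and its
   diameter is [d]: all distances in [S] exist, and [d] is their maximum. *)
Definition graph_diameter (V : Type) (S : set V) (e : V -> V -> Prop) (d : nat)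
    : Prop :=
  (exists v w, [/\ S v, S w & graph_dist e v w d]) /\
  (forall v w, S v -> S w -> exists2 k, graph_dist e v w k & (k <= d)%N).

Section Polytope.
Variables (R : realFieldType) (V : vectType R).
Implicit Types (P F : set V) (v w : V).

(* Nonempty faces; [P] itself is one, with [c = 0] and [b = 0]. *)
Definition face P F : Prop :=
  F !=set0 /\
  exists (c : 'Hom(V, R^o)) (b : R),
    (forall x, P x -> c x <= b) /\ F = [set x | P x /\ c x = b].

(* The affine hull of the nonempty set [F] has dimension [d]: it is [x0 + U],
   where [U] has as a basis [d] differences of points of [F]. *)
Definition affine_dim F (d : nat) : Prop :=
  exists (x0 : V) (s : d.-tuple V),
    let D := [seq x - x0 | x <- s] in
    [/\ F x0, {in s, forall x, F x}, free D
      & forall y, F y -> y - x0 \in <<D>>%VS].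

Definition vertex P : set V := [set v | face P [set v]].

Definition adjacent P v w : Prop :=
  [/\ vertex P v, vertex P w, v <> w
    & exists F, [/\ face P F, affine_dim F 1, F v & F w]].

Definition combinatorial_diameter P (d : nat) : Prop :=
  graph_diameter (vertex P) (adjacent P) d.

End Polytope.

Definition partition_polytope (R : realFieldType) (n : nat) (kappa : 'I_n -> nat)
    : set 'M[R]_(n, \sum_i kappa i) :=
  [set y | [/\ forall i, \sum_j y i j = (kappa i)%:R,
               forall j, \sum_i y i j = 1
             & forall i j, 0 <= y i j]].

Arguments partition_polytope R {n} kappa _.

(* Main.v *)
Require Import Defs.
From HB Require Import structures.
From mathcomp Require Import all_boot all_order all_algebra all_fingroup.
From mathcomp Require Import classical_sets reals.
From mathcomp Require Import boolp zify.
From mathcomp Require Import fintype finset.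

(** Vertices of the polytope are 0/1 matrices, that is, assignments of the
    items to the clusters with prescribed fibres: Hall's theorem puts an
    assignment inside the support of any point, and a point that differs from
    it can be moved a little towards it and away from it
    ([vertex_integral]).  Two assignments are joined by an edge as soon as they
    differ by a cyclic exchange, in which every cluster of a cycle of clusters
    hands one item to the next cluster ([step_adjacent]).  It remains to link
    two assignments [f] and [g], with fibres of at most two items, by three
    cyclic exchanges ([three_steps]).

    Draw every item [j] as an arc from [f j] to [g j].  By Hall's theorem the
    arcs split into two classes, each of which follows a permutation of the
    clusters, [s1] and [s2] say ([splitting_exists]).  Each permutation is
    a product of two cycles: composing with a cycle through one point of every
    nontrivial orbit merges these orbits into one ([transversal_cycle]).  Hence
    [s1] is [c1] followed by [r], and [s2] is [t] followed by [c3], where [r]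
    and [t] are cycles on transversals [T1] and [T2] of the nontrivial orbits.
    This alone would give four exchanges.

    One exchange is saved by performing [c1] first, [c3] last, and [r] together
    with [t] in between.  When [T1] and [T2] are disjoint, [r * t] consists of
    two disjoint cycles, which still have to be merged.  For this, choose [T1]
    and [T2] such that some [b] in [T2] satisfies [s2 b \in T1]
    ([disjoint_transversals], Hall's theorem once more).  Put [a = s2 b].  One
    item of each class ends in [a]; which of the two waits in [a], and which
    one is carried there by the last exchange [c3], is a free choice.
    Exchanging their roles multiplies the middle permutation by a transposition
    of a point of [T1] and a point of [T2], and thus turns it into a single
    cycle ([merged_cycle], [three_steps_overlap]).  Such an [a] exists unless no
    cluster is moved by both permutations; in that case [s1 * s2] is followed
    by all moving items at once, and two exchanges suffice ([two_steps]). *)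

Set Implicit Arguments.
Unset Strict Implicit.
Unset Printing Implicit Defensive.

Import Order.TTheory GRing.Theory Num.Theory.
Local Open Scope ring_scope.

(** * Hall's theorem *)

Section Hall.
Local Open Scope nat_scope.
Local Open Scope set_scope.
Variables A B : finType.
Implicit Types (r : A -> B -> bool) (S T : {set A}) (U : {set B}).

Definition neighbours r T : {set B} := [set b | [exists a in T, r a b]].

Lemma neighboursP r T b :
  reflect (exists2 a, a \in T & r a b) (b \in neighbours r T).
Proof. by rewrite inE; apply: (iffP exists_inP) => -[a]; exists a. Qed.

Definition hall_condition r S :=
  forall T, T \subset S -> #|T| <= #|neighbours r T|.

Lemma neighboursU r S T :
  neighbours r (S :|: T) = neighbours r S :|: neighbours r T.
Proof.
apply/setP => b; rewrite in_setU; apply/neighboursP/orP.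
  by case=> a /setUP[] aS rab; [left | right]; apply/neighboursP; exists a.
by case=> /neighboursP[a aS rab]; exists a; rewrite // inE aS ?orbT.
Qed.

Definition avoiding r U a b := r a b && (b \notin U).

Lemma neighbours_avoiding r U T :
  neighbours (avoiding r U) T = neighbours r T :\: U.
Proof.
apply/setP => b; rewrite in_setD; apply/neighboursP/andP.
  by case=> a aT /andP[rab bU]; split=> //; apply/neighboursP; exists a.
by case=> bU /neighboursP[a aT rab]; exists a => //; rewrite /avoiding rab.
Qed.

(** Both cases of the induction for Hall's theorem end this way: [T] is matched
    into [U], and the rest of [S] is matched outside of [U]. *)
Lemma matching_glue r S T U (h1 h2 : A -> B) :
    {in T &, injective h1} -> {in S :\: T &, injective h2} ->
    {in T, forall a, h1 a \in U /\ r a (h1 a)} ->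
    {in S :\: T, forall a, avoiding r U a (h2 a)} ->
  exists h : A -> B, {in S &, injective h} /\ {in S, forall a, r a (h a)}.
Proof.
move=> inj1 inj2 r1 r2; exists (fun a => if a \in T then h1 a else h2 a).
split=> [a a' aS a'S | a aS].
  case: ifPn => aT; case: ifPn => a'T.
  - exact: inj1.
  - have /andP[_ /negP a'U] : avoiding r U a' (h2 a') by apply: r2; rewrite inE a'T.
    by move=> eqh; case: a'U; rewrite -eqh; case: (r1 a aT).
  - have /andP[_ /negP aU] : avoiding r U a (h2 a) by apply: r2; rewrite inE aT.
    by move=> eqh; case: aU; rewrite eqh; case: (r1 a' a'T).
  - by apply: inj2; rewrite inE ?aT ?a'T.
case: ifPn => aT; first by case: (r1 a aT).
by have /andP[] : avoiding r U a (h2 a) by apply: r2; rewrite inE aT.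
Qed.

(** Induction on the size of [S], following Halmos and Vaughan.  If a proper
    nonempty [T] has exactly [#|T|] neighbours, these are used up by [T], and
    Hall's condition survives on [S :\: T] when they are deleted.  Otherwise every
    such [T] has a neighbour to spare, so any edge [a0 - b] may be used. *)
Theorem hall (b0 : B) r S : hall_condition r S ->
  exists h : A -> B, {in S &, injective h} /\ {in S, forall a, r a (h a)}.
Proof.
have [n] := ubnP #|S|; elim: n r S => // n IHn r S /ltnSE-leSn hallS.
have [->|[a0 a0S]] := set_0Vmem S.
  by exists (fun=> b0); split=> [a a'|a]; rewrite inE.
case: (boolP [exists T : {set A},
    [&& T != set0, T \proper S & #|neighbours r T| == #|T|]]).
  case/existsP=> T /and3P[T0 ltTS /eqP tightT].
  have sTS := proper_sub ltTS.
  have [||h1 [inj1 r1]] := IHn r T.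
  - by apply: leq_trans leSn; apply: proper_card.
  - by move=> U sUT; apply: hallS; apply: subset_trans sUT sTS.
  have [||h2 [inj2 r2]] := IHn (avoiding r (neighbours r T)) (S :\: T).
  - apply: leq_trans leSn; apply: proper_card; rewrite properE subsetDl.
    have /set0Pn[a aT] := T0; apply/subsetPn.
    by exists a; [apply: (subsetP sTS) | rewrite inE aT].
  - move=> T' /subsetDP[sT'S disT']; rewrite neighbours_avoiding.
    rewrite -(leq_add2l #|neighbours r T|).
    have ->: #|neighbours r T| + #|neighbours r T' :\: neighbours r T|
        = #|neighbours r (T :|: T')|.
      rewrite neighboursU -[RHS](cardsID (neighbours r T)).
      by rewrite (setIidPr (subsetUl _ _)) setDUl setDv set0U.
    have <-: #|T :|: T'| = #|neighbours r T| + #|T'|.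
      rewrite tightT; apply/eqP; rewrite (leq_card_setU T T').2.
      by rewrite disjoint_sym.
    by apply: hallS; rewrite subUset sTS.
  apply: (matching_glue inj1 inj2 _ r2) => a aT.
  by split; [apply/neighboursP; exists a; rewrite ?r1 | apply: r1].
move/existsPn=> slack.
have ltS1 : #|S :\ a0| < n by rewrite (cardsD1 a0) a0S in leSn.
have [N0|[b rb]] := set_0Vmem (neighbours r [set a0]).
  have := hallS [set a0]; rewrite sub1set a0S N0 cards1 cards0.
  by move/(_ isT).
have rab : r a0 b by case/neighboursP: rb => _ /set1P->.
have [|h [injh rh]] := IHn (avoiding r [set b]) (S :\ a0) ltS1.
  move=> T /subsetD1P[sTS a0T]; rewrite neighbours_avoiding.
  have [->|T0] := eqVneq T set0; first by rewrite cards0.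
  have pTS : T \proper S.
    by rewrite properE sTS; apply/subsetPn; exists a0.
  have := slack T; rewrite T0 pTS /= neq_ltn ltnNge hallS //=.
  rewrite (cardsD1 b (neighbours r T)); case: (b \in _) => //.
  exact: ltnW.
apply: (@matching_glue r S [set a0] [set b] (fun=> b) h) => //.
  by move=> a a' /set1P-> /set1P->.
by move=> a /set1P->; rewrite set11.
Qed.
End Hall.

(** * Cycles of permutations and how they merge *)

Section Cycles.
Local Open Scope nat_scope.
Local Open Scope group_scope.
Variable I : finType.
Implicit Types (s t : {perm I}) (T B C : {set I}).

(** To be a single cycle is expressed below by a dichotomy for invariant sets,
    which passes to products of permutations and to conserved flows more easily
    than an enumeration of the cycle. *)
Definition stable s B : Prop := {in B, forall x, s x \in B}.

Lemma stable_mem s B x : stable s B -> (s x \in B) = (x \in B).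
Proof.
move=> stB; have sB : s @: B = B.
  apply/eqP; rewrite eqEcard card_imset ?leqnn ?andbT; last exact: perm_inj.
  by apply/subsetP => _ /imsetP[y yB ->]; apply: stB.
by rewrite -{1}sB mem_imset //; apply: perm_inj.
Qed.

Lemma stableV s B : stable s^-1 B <-> stable s B.
Proof.
by split=> stB x; [rewrite -(stable_mem (s x) stB) permK
                 | rewrite -(stable_mem (s^-1 x) stB) permKV].
Qed.

Lemma stableC s B : stable s B -> stable s (~: B).
Proof. by move=> stB x; rewrite !inE (stable_mem _ stB). Qed.

Lemma stable_porbit s x : stable s (porbit s x).
Proof.
by move=> y /porbitP[i ->]; rewrite -permM -expgSr mem_porbit.
Qed.

Lemma stable_subset_porbit s B x : stable s B -> x \in B -> porbit s x \subset B.
Proof.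
move=> stB xB; apply/subsetP => _ /porbitP[i ->].
by elim: i => [|i IHi]; rewrite ?perm1 // expgSr permM stB.
Qed.

Definition moved s : {set I} := [set x | s x != x].

Lemma perm_on_moved s : perm_on (moved s) s.
Proof. by apply/subsetP => x; rewrite !inE. Qed.

Lemma stable_moved s : stable s (moved s).
Proof. by move=> x; rewrite !inE (inj_eq perm_inj). Qed.

(** Multiplying by a transposition of points in different orbits joins the two
    orbits.  If an invariant [B] of the product contained [x] and not [y], then
    [B :&: C] would be invariant under [s], because inside [C] the product differs
    from [s] only at [y]; but it would contain [s y] and not [y]. *)
Lemma merge_orbits s x y B C :
    stable s C -> x \notin C -> y \in C -> stable (tperm x y * s) B ->
  (x \in B) = (y \in B) /\ stable s B.
Proof.
move=> stC xC yC stB.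
have sub B' C' x' y' : stable s C' -> x' \notin C' -> y' \in C' ->
    stable (tperm x' y' * s) B' -> x' \in B' -> y' \in B'.
  move=> stC' x'C y'C stB' x'B; apply: contraT => y'B.
  have stBC : stable s (B' :&: C').
    move=> z /setIP[zB zC]; rewrite inE stC' // andbT.
    have := stB' z zB; rewrite permM tpermD //.
      by apply: contraNneq x'C => ->.
    by apply: contraNneq y'B => ->.
  have : s y' \in B' :&: C'.
    by rewrite inE stC' // andbT; have := stB' x' x'B; rewrite permM tpermL.
  by rewrite (stable_mem _ stBC) inE (negPf y'B).
have eqB : (x \in B) = (y \in B).
  apply/idP/idP; first exact: sub stC xC yC stB.
  apply: (sub _ _ _ _ (stableC stC)); rewrite ?inE ?negbK //.
  by rewrite tpermC.
split=> // z zB; have [zx|zx] := eqVneq z x.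
  have yB : y \in B by rewrite -eqB -zx.
  by have := stB y yB; rewrite permM tpermR zx.
have [zy|zy] := eqVneq z y.
  have xB : x \in B by rewrite eqB -zy.
  by have := stB x xB; rewrite permM tpermL zy.
by have := stB z zB; rewrite permM tpermD // eq_sym.
Qed.

(** [t] is one cycle through all of [T].  A singleton [T] is allowed, and then
    [t] is the identity. *)
Definition cycle_on t T : Prop :=
  perm_on T t /\ forall B, stable t B -> T \subset B \/ [disjoint T & B].

Lemma cycle_onV t T : cycle_on t T -> cycle_on t^-1 T.
Proof.
case=> onT indec; split; last by move=> B /stableV; apply: indec.
by apply/subsetP => x; rewrite inE (canF_eq (permKV t)) eq_sym; apply/subsetP: x.
Qed.

Definition transversal_of s T : Prop :=
  [/\ T \subset moved s,
      forall x, x \in moved s -> exists2 y, y \in T & x \in porbit s y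
    & {in T &, forall x y, x \in porbit s y -> x = y}].

Lemma movedV s : moved s^-1 = moved s.
Proof. by apply/setP => x; rewrite !inE (canF_eq (permKV s)) eq_sym. Qed.

Lemma transversal_of_inv s T : transversal_of s T -> transversal_of s^-1 T.
Proof.
case=> sT cov uni; split; rewrite ?movedV // => x.
  by case/cov=> y yT xy; exists y; rewrite ?porbitV.
by move=> y xT yT; rewrite porbitV; apply: uni.
Qed.

(** The permutation is the product of the transpositions of [x] with the other
    points, each of which merges one more orbit into that of [x].  It is needed
    for two permutations [s] at once: for [s := 1] it says that [t] itself is a
    cycle. *)
Lemma star_merge x (ys : seq I) : uniq (x :: ys) ->
  exists t, perm_on [set y in x :: ys] t /\
    forall s B, {in x :: ys &, forall y z, y \in porbit s z -> y = z} ->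
      stable (t * s) B ->
    stable s B /\ {in ys, forall y, (x \in B) = (y \in B)}.
Proof.
elim: ys => [|y ys IHys].
  by move=> _; exists 1; rewrite perm_on1; split=> // s B _; rewrite mul1g.
rewrite /= inE negb_or -andbA => /and4P[xy xys yys uys].
have [|t [on_t merge_t]] := IHys; first by rewrite /= xys.
exists (tperm x y * t); split.
  apply: perm_onM.
    apply/subsetP => z; rewrite !inE; case: tpermP => [->|->|]; rewrite eqxx ?orbT //.
  apply: subset_trans on_t _; apply/subsetP => z.
  by rewrite !inE => /orP[]->; rewrite ?orbT.
move=> s B sep; rewrite -mulgA => stB.
have sub z : z \in x :: ys -> z \in [:: x, y & ys].
  by rewrite !inE => /orP[]->; rewrite ?orbT.
have y_in : y \in [:: x, y & ys] by rewrite !inE eqxx orbT.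
have off_orbit z : z \in x :: ys -> z \notin porbit s y.
  move=> zx; apply/negP => /(sep _ _ (sub z zx) y_in) zy.
  by move: zx; rewrite zy inE eq_sym (negPf xy) (negPf yys).
have st_orbit : stable (t * s) (porbit s y).
  move=> z zy; rewrite permM (out_perm on_t); first exact: stable_porbit.
  by rewrite inE; apply: contraL zy; apply: off_orbit.
have [|eq_xy st_tB] := merge_orbits st_orbit _ (porbit_id s y) stB.
  by apply: off_orbit; rewrite mem_head.
have [|stsB eq_ys] := merge_t s B _ st_tB.
  by move=> z z' zin z'in; apply: sep; apply: sub.
by split=> // z; rewrite inE => /predU1P[->|/eq_ys].
Qed.

Lemma transversal_cycle s T : transversal_of s T ->
  exists t, cycle_on t T /\ cycle_on (t * s) (moved s).
Proof.
case=> sT cov uni; have [T0|[x xT]] := set_0Vmem T.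
  have s1 : moved s = set0.
    by apply/eqP; rewrite -subset0; apply/subsetP => x /cov[y]; rewrite T0 inE.
  have none t : perm_on set0 t -> cycle_on t set0.
    by split=> // B _; left; apply: sub0set.
  exists 1; rewrite mul1g T0 s1; split; apply: none; first exact: perm_on1.
  by rewrite -s1; apply: perm_on_moved.
have eqT : [set y in x :: enum (T :\ x)] = T.
  by apply/setP => y; rewrite !inE mem_enum !inE; case: eqVneq => [->|].
have inT y : (y \in x :: enum (T :\ x)) = (y \in T).
  by rewrite -[in RHS]eqT in_set.
have [|t [on_t merge_t]] := @star_merge x (enum (T :\ x)).
  by rewrite /= enum_uniq mem_enum !inE eqxx.
rewrite eqT in on_t.
have all_or_none B : {in enum (T :\ x), forall y, (x \in B) = (y \in B)} ->
    T \subset B \/ [disjoint T & B].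
  move=> eqB; have eqTB y : y \in T -> (y \in B) = (x \in B).
    by move=> yT; have [->//|yx] := eqVneq y x; rewrite -eqB // mem_enum !inE yx.
  case: (boolP (x \in B)) => xB; [left|right].
    by apply/subsetP => y yT; rewrite eqTB.
  by rewrite disjoint_subset; apply/subsetP => y yT; rewrite inE eqTB.
exists t; split; split=> //.
- move=> B stB; rewrite -[t]mulg1 in stB.
  have [|_] := merge_t 1 B _ stB; last exact: all_or_none.
  by move=> y z _ _ /porbitP[i ->]; rewrite expg1n perm1.
- apply: perm_onM; last exact: perm_on_moved.
  exact: subset_trans on_t sT.
- move=> B stB; have [|stsB] := merge_t s B _ stB.
    by move=> y z; rewrite !inT; apply: uni.
  case/all_or_none=> TB; [left | right].
    apply/subsetP => y /cov[z zT]; apply: subsetP.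
    by apply: stable_subset_porbit => //; apply: (subsetP TB).
  rewrite disjoint_subset; apply/subsetP => y /cov[z zT yz].
  rewrite inE; apply/negP => yB; rewrite porbit_sym in yz.
  have := subsetP (stable_subset_porbit stsB yB) z yz.
  by rewrite (disjointFr TB).
Qed.
End Cycles.

(** * Splitting the arcs into two permutations *)

Section HallTwo.
Local Open Scope nat_scope.
Local Open Scope set_scope.

(** The usual double count behind the matchings in regular bipartite graphs,
    for weights with row sums at least two and column sums at most two.  The
    integrality of cardinals tolerates the loss of a single unit, at the row
    [a0]. *)
Lemma hall_two (A B : finType) (b0 : B) (S : {set A}) (w : A -> B -> nat) (a0 : A) :
    {in S, forall a, 2 <= (a == a0) + \sum_b w a b} ->
    (forall b, \sum_(a in S) w a b <= 2) ->
  exists h : A -> B, {in S &, injective h} /\ {in S, forall a, 0 < w a (h a)}.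
Proof.
move=> rows cols; apply: (@hall A B b0 (fun a b => 0 < w a b)) => T sTS.
set N := neighbours _ T.
have rowsT : 2 * #|T| <= 1 + \sum_(a in T) \sum_b w a b.
  have: \sum_(a in T) 2 <= \sum_(a in T) ((a == a0) + \sum_b w a b).
    by apply: leq_sum => a aT; apply: rows; apply: (subsetP sTS).
  rewrite sum_nat_const mulnC big_split /= => /leq_trans; apply.
  rewrite leq_add2r -big_mkcondr /= sum1_card.
  rewrite -(cards1 a0); apply: subset_leq_card; apply/subsetP => a.
  by rewrite !inE => /andP[].
have colsT : \sum_(a in T) \sum_b w a b <= 2 * #|N|.
  rewrite exchange_big /= (bigID (mem N)) /= [X in _ + X]big1 ?addn0.
    rewrite mulnC -sum_nat_const; apply: leq_sum => b _.
    apply: leq_trans (cols b).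
    rewrite [leqRHS](big_setID T) /= (setIidPr sTS); exact: leq_addr.
  move=> b bN; apply: big1 => a aT; apply/eqP; rewrite -leqn0 leqNgt.
  by apply: contra bN => wab; apply/neighboursP; exists a.
have := leq_trans rowsT (leq_add (leqnn 1) colsT).
by lia.
Qed.
End HallTwo.

Section Splitting.
Local Open Scope nat_scope.
Local Open Scope group_scope.
Variables (I J : finType).
Implicit Types (f g : J -> I).

Definition fibre f x : {set J} := [set j | f j == x].

(** A class may miss a cluster with fewer than two items; its permutation then
    has a fixed point there, which is why both are full permutations while only
    their moved points are required to carry items. *)
Record splitting f g (lam : J -> bool) (pi : bool -> {perm I}) : Prop :=
  Splitting {
    split_arc : forall j, g j = pi (lam j) (f j);
    split_inj : forall j k, lam j = lam k -> f j = f k -> j = k;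
    split_item : forall b x, x \in moved (pi b) -> exists2 j, lam j = b & f j = x }.

(** Adding [2 - #|fibre f x|] loops at each [x] makes the multigraph of the arcs
    regular of degree two.  A perfect matching of sources and targets gives the
    first permutation [p]; the arcs that are left follow the second one. *)
Lemma splitting_exists (x0 : I) f g :
    (forall x, #|fibre f x| = #|fibre g x|) -> (forall x, #|fibre f x| <= 2) ->
  exists lam pi, splitting f g lam pi.
Proof.
move=> fib le2.
pose w x y := #|fibre f x :&: fibre g y| + (x == y) * (2 - #|fibre f x|).
have rowE x : \sum_y #|fibre f x :&: fibre g y| = #|fibre f x|.
  rewrite -sum1_card (partition_big g xpredT) //=; apply: eq_bigr => y _.
  by rewrite -sum1_card; apply: eq_bigl => j; rewrite !inE.
have colE y : \sum_x #|fibre f x :&: fibre g y| = #|fibre g y|.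
  rewrite -sum1_card (partition_big f xpredT) //=; apply: eq_bigr => x _.
  by rewrite -sum1_card; apply: eq_bigl => j; rewrite !inE andbC.
have deltaE (F : I -> nat) x : \sum_y (x == y) * F y = F x.
  by rewrite (bigD1 x) //= eqxx mul1n big1 ?addn0 // => y; rewrite eq_sym => /negPf->.
have [||h [injh wh]] := @hall_two I I x0 [set: I] w x0.
- move=> x _; rewrite big_split /= rowE.
  have -> : \sum_y (x == y) * (2 - #|fibre f x|) = 2 - #|fibre f x|.
    exact: (deltaE (fun=> _)).
  by rewrite subnKC // leq_addl.
- move=> y; rewrite big_split /=.
  under eq_bigl do rewrite inE.
  rewrite colE.
  under eq_bigl do rewrite inE.
  under eq_bigr do rewrite eq_sym.
  by rewrite (deltaE (fun x => 2 - #|fibre f x|)) fib subnKC // -fib.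
have {}injh : injective h by move=> x y; apply: injh; rewrite inE.
have {}wh x : 0 < w x (h x) by apply: wh; rewrite inE.
pose p := perm injh.
(* Where only an added loop realizes the matching, [e x] is [None]. *)
pose e x := [pick j in fibre f x :&: fibre g (h x)].
pose lam j := e (f j) == Some j.
(* The clusters that an item of the first class leaves, and, [h] fixing all
   others, also those that such an item enters. *)
pose E := [set x | isSome (e x)].
have lamP x j : e x = Some j -> f j = x /\ g j = h x.
  by rewrite /e; case: pickP => // k; rewrite !inE => /andP[/eqP fk /eqP gk] [<-].
have notE x : x \notin E -> h x = x /\ #|fibre f x| <= 1.
  rewrite inE /e; case: pickP => // no_item _; have := wh x; rewrite /w.
  have -> : #|fibre f x :&: fibre g (h x)| = 0 by apply: eq_card0.
  by case: eqVneq => // <-; rewrite mul1n add0n subn_gt0 ltnS.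
have stE : stable p E.
  rewrite -[E]setCK; apply: stableC => x; rewrite inE => xE.
  by rewrite permE (notE x xE).1 inE.
have lam_f x : #|fibre f x :&: [set j | lam j]| = (x \in E).
  rewrite inE; case ex: (e x) => [l|] /=.
    have [fl gl] := lamP _ _ ex.
    rewrite -(cards1 l); apply: eq_card => j; rewrite !inE /lam.
    apply/andP/eqP => [[/eqP-> /eqP]|->]; first by rewrite ex => -[].
    by rewrite fl ex.
  apply: eq_card0 => j; rewrite !inE /lam; apply/andP => -[/eqP->].
  by rewrite ex.
have lam_g x : #|fibre g x :&: [set j | lam j]| = (x \in E).
  rewrite -(permKV p x) (stable_mem _ stE) -lam_f; apply: eq_card => j.
  rewrite !inE; case lj: (lam j); rewrite ?andbF // !andbT.
  have [_ ->] := lamP _ _ (eqP lj).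
  by rewrite -(permE injh) (inj_eq perm_inj).
have rest_f x : #|fibre f x :\: [set j | lam j]| <= 1.
  rewrite cardsD lam_f; case: (boolP (x \in E)) => [_|/notE[_]]; last by rewrite subn0.
  by rewrite leq_subLR.
have rest_g x : #|fibre g x :\: [set j | lam j]| = #|fibre f x :\: [set j | lam j]|.
  by rewrite !cardsD lam_f lam_g fib.
have injf j k : ~~ lam j -> ~~ lam k -> f j = f k -> j = k.
  move=> lj lk fjk; apply: (card_le1_eqP (rest_f (f j))); rewrite !inE.
    by rewrite lk fjk /=.
  by rewrite lj /=.
have injg j k : ~~ lam j -> ~~ lam k -> g j = g k -> j = k.
  move=> lj lk gjk; have := rest_f (g j); rewrite -rest_g => le1.
  apply: (card_le1_eqP le1); rewrite !inE.
    by rewrite lk gjk /=.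
  by rewrite lj /=.
(* The permutation of the second class. *)
pose q x := if [pick j in fibre f x :\: [set j | lam j]] is Some j then g j else x.
have qP j : ~~ lam j -> q (f j) = g j.
  move=> lj; rewrite /q; case: pickP => [k|/(_ j)]; rewrite !inE ?lj ?eqxx //=.
  by case/andP=> lk /eqP fk; rewrite (injf k j).
have q0 x : (forall j, ~~ lam j -> f j <> x) -> q x = x.
  move=> no; rewrite /q; case: pickP => // j; rewrite !inE => /andP[lj /eqP fj].
  by case: (no j lj).
have qcase x : (exists2 j, ~~ lam j & f j = x) \/ (forall j, ~~ lam j -> f j <> x).
  case: (pickP (fun j => ~~ lam j && (f j == x))) => [j /andP[lj /eqP fj]|no].
    by left; exists j.
  by right=> j lj fj; have := no j; rewrite lj fj eqxx.
have noarc j x : ~~ lam j -> (forall j, ~~ lam j -> f j <> x) -> g j <> x.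
  move=> lj no gj; have : 0 < #|fibre g x :\: [set j | lam j]|.
    by apply/card_gt0P; exists j; rewrite !inE lj gj eqxx.
  rewrite rest_g => /card_gt0P[k]; rewrite !inE => /andP[lk /eqP].
  exact: no.
have injq : injective q.
  move=> x y; case: (qcase x) => [[j lj <-]|nox]; case: (qcase y) => [[k lk <-]|noy].
  - by rewrite !qP // => /injg->.
  - by rewrite qP // q0 // => /(noarc _ _ lj noy).
  - by rewrite q0 // qP // => /esym/(noarc _ _ lk nox).
  - by rewrite !q0.
exists lam, (fun b => if b then p else perm injq); split.
- move=> j; case: ifPn => lj; rewrite permE ?qP //.
  by have [] := lamP _ _ (eqP lj).
- move=> j k; case: (boolP (lam k)) => lk; case: (boolP (lam j)) => lj // _ fjk.
    by move: lj lk; rewrite /lam fjk => /eqP-> /eqP[].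
  exact: injf.
- move=> [] x; rewrite inE permE.
    case: (boolP (x \in E)) => [|/notE[-> _]]; rewrite ?eqxx // inE.
    case ex: (e x) => [j|] // _ _; exists j; last by case: (lamP _ _ ex).
    by rewrite /lam (lamP _ _ ex).1 ex eqxx.
  case: (qcase x) => [[j lj fj] _|no]; last by rewrite q0 ?eqxx.
  by exists j => //; apply: negPf.
Qed.
End Splitting.

(** * Disjoint transversals *)

Section Transversals.
Local Open Scope nat_scope.
Local Open Scope group_scope.
Variable I : finType.
Implicit Types (s t r : {perm I}) (T B C : {set I}).

Lemma transversal_of_choice s (k : {set I} -> I) :
    {in moved s, forall x, k (porbit s x) \in porbit s x} ->
  transversal_of s [set k (porbit s x) | x in moved s].
Proof.
move=> kP; split.
- apply/subsetP => _ /imsetP[x xs ->].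
  exact: (subsetP (stable_subset_porbit (@stable_moved _ s) xs)) (kP x xs).
- move=> x xs; exists (k (porbit s x)); first exact: imset_f.
  by rewrite porbit_sym kP.
- move=> _ _ /imsetP[x xs ->] /imsetP[y ys ->].
  have := kP x xs; rewrite -eq_porbit_mem => /eqP ex.
  have := kP y ys; rewrite -eq_porbit_mem => /eqP ey.
  by rewrite -eq_porbit_mem ex ey => /eqP->.
Qed.

Lemma transversal_exists s : exists T, transversal_of s T.
Proof.
have [s1|[x0 x0s]] := set_0Vmem (moved s).
  by exists set0; split; rewrite ?s1 // => x; rewrite inE.
pose k C := odflt x0 [pick y in C].
exists [set k (porbit s x) | x in moved s]; apply: transversal_of_choice => x _.
by rewrite /k; case: pickP => // /(_ x); rewrite porbit_id.
Qed.

Lemma card_porbit_moved s x : x \in moved s -> 1 < #|porbit s x|.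
Proof.
rewrite inE => sx; apply/card_gt1P; exists x, (s x); split; rewrite ?porbit_id //.
  by rewrite -{1}[s]expg1 mem_porbit.
by rewrite eq_sym.
Qed.

(** The nontrivial orbits of [s1] and [s2] need distinct representatives, where
    [a] and [b] are already assigned.  Each orbit has at least two points and
    each point lies in at most two orbits, so Hall's condition would hold with
    nothing reserved.  Both orbits through [a] are served by [a] and [b] (the
    orbit of [b] under [s2] contains [a]), so the only orbit that can lose a point
    is that of [b] under [s1], which loses only [b]. *)
Lemma disjoint_transversals s1 s2 a b :
    a \in moved s1 -> b \in moved s2 -> s2 b = a ->
  exists T1 T2, [/\ transversal_of s1 T1, transversal_of s2 T2, a \in T1, b \in T2
    & [disjoint T1 & T2]].
Proof.
move=> a1 b2 s2b.
have ab : a != b by rewrite -s2b; rewrite inE in b2.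
pose p (l : bool) := if l then s1 else s2; pose d (l : bool) := if l then a else b.
have a_orbit l : a \in porbit (p l) (d l).
  by case: l; rewrite /= ?porbit_id // -s2b -{1}[s2]expg1 mem_porbit.
pose S := [set n : bool * {set I} | (n.2 != porbit (p n.1) (d n.1)) &&
  (n.2 \in [set porbit (p n.1) x | x in moved (p n.1)])].
pose w (n : bool * {set I}) x : nat := [&& x \in n.2, x != a & x != b].
have [||h [injh wh]] := @hall_two _ _ a S w (true, porbit s1 b).
- move=> [l C]; rewrite inE /= => /andP[Cd /imsetP[x xs defC]].
  have -> : \sum_y w (l, C) y = #|C :\ b|.
    rewrite -sum1_card [RHS]big_mkcond; apply: eq_bigr => y _; rewrite /w !inE /=.
    case yC: (y \in C); rewrite ?andbF //= andbT.
    have -> : y != a.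
      apply: contraNneq Cd => ya; move: yC (a_orbit l).
      by rewrite ya defC -!eq_porbit_mem => /eqP <-.
    by case: (y == b).
  have : 1 < #|C| by rewrite defC; apply: card_porbit_moved.
  rewrite (cardsD1 b) => /leq_trans; apply; rewrite leq_add2r.
  case bC: (b \in C) => //; case: l Cd defC {xs} => /= Cd defC.
    rewrite xpair_eqE /= defC eq_porbit_mem porbit_sym.
    by move: bC; rewrite defC => ->.
  by case/negP: Cd; move: bC; rewrite defC eq_porbit_mem porbit_sym.
- move=> x; apply: (@leq_trans #|[set (true, porbit s1 x); (false, porbit s2 x)]|).
    rewrite -sum1_card big_mkcond [leqRHS]big_mkcond; apply: leq_sum => -[l C] _.
    case: ifP => //; rewrite inE /= => /andP[_ /imsetP[y _ ->]].
    rewrite /w /=; case xy: (x \in _); last by rewrite /=; case: ifP.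
    move: xy; rewrite -eq_porbit_mem => /eqP <-.
    by rewrite !inE !xpair_eqE; case: l => /=; rewrite eqxx ?orbT; case: (_ && _).
  by rewrite cards2; case: (_ != _).
pose k l C := if C == porbit (p l) (d l) then d l else h (l, C).
have hP l x : x \in moved (p l) -> porbit (p l) x != porbit (p l) (d l) ->
    [/\ (l, porbit (p l) x) \in S, h (l, porbit (p l) x) \in porbit (p l) x,
        h (l, porbit (p l) x) != a & h (l, porbit (p l) x) != b].
  move=> xs xd; have xS : (l, porbit (p l) x) \in S.
    by rewrite inE /= xd; apply: imset_f.
  by have := wh _ xS; rewrite lt0b => /and3P[].
have kP l : {in moved (p l), forall x, k l (porbit (p l) x) \in porbit (p l) x}.
  move=> x xs; rewrite /k; case: eqVneq => [->|xd]; first exact: porbit_id.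
  by case: (hP l x xs xd).
have mem_d l : d l \in [set k l (porbit (p l) x) | x in moved (p l)].
  by apply/imsetP; exists (d l); [case: l | rewrite /k eqxx].
exists [set k true (porbit s1 x) | x in moved s1].
exists [set k false (porbit s2 x) | x in moved s2]; split.
- exact: transversal_of_choice (kP true).
- exact: transversal_of_choice (kP false).
- exact: mem_d true.
- exact: mem_d false.
rewrite disjoint_subset; apply/subsetP => _ /imsetP[x xs1 ->].
rewrite inE; apply/negP => /imsetP[y ys2]; rewrite /k.
case: eqVneq => [_|xd]; case: eqVneq => [_|yd] /=.
- by move/eqP; rewrite (negPf ab).
- by move/eqP; rewrite eq_sym; have [_ _ /negPf->] := hP false y ys2 yd.
- by move/eqP; have [_ _ _ /negPf->] := hP true x xs1 xd.
- have [xS _ _ _] := hP true x xs1 xd; have [yS _ _ _] := hP false y ys2 yd.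
  by move/(injh _ _ xS yS).
Qed.

Lemma merged_cycle r t T1 T2 u w :
    cycle_on r T1 -> cycle_on t T2 -> [disjoint T1 & T2] -> u \in T1 -> w \in T2 ->
  cycle_on (tperm u w * (r * t)) (T1 :|: T2).
Proof.
move=> [on_r cyc_r] [on_t cyc_t] disT uT1 wT2.
have r_id z : z \in T2 -> r z = z.
  by move=> zT2; rewrite (out_perm on_r) // (disjointFl disT).
have t_id z : z \in T1 -> t z = z.
  by move=> zT1; rewrite (out_perm on_t) // (disjointFr disT).
split.
  apply: perm_onM; last apply: perm_onM.
  - apply: subset_trans (tperm_on _ _) _.
    by rewrite subUset !sub1set !inE uT1 wT2 orbT.
  - exact: subset_trans on_r (subsetUl _ _).
  - exact: subset_trans on_t (subsetUr _ _).
move=> B stB.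
have stT2 : stable (r * t) T2.
  by move=> z zT2; rewrite permM r_id // (perm_closed _ on_t).
have [|eq_uw st_rt] := merge_orbits stT2 _ wT2 stB.
  by rewrite (disjointFr disT).
have st_r : stable r B.
  move=> z zB; case: (boolP (z \in T1)) => zT1; last by rewrite (out_perm on_r).
  by have := st_rt z zB; rewrite permM t_id // (perm_closed _ on_r).
have st_t : stable t B.
  move=> z zB; case: (boolP (z \in T2)) => zT2; last by rewrite (out_perm on_t).
  by have := st_rt z zB; rewrite permM r_id.
case: (cyc_r _ st_r) => T1B; case: (cyc_t _ st_t) => T2B.
- by left; rewrite subUset T1B.
- by have := disjointFr T2B wT2; rewrite -eq_uw (subsetP T1B).
- by have := disjointFr T1B uT1; rewrite eq_uw (subsetP T2B).
- right; move: T1B T2B; rewrite -!setI_eq0 setIUl => /eqP-> /eqP->.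
  by rewrite setU0.
Qed.
End Transversals.

(** * Linking two assignments by three cyclic exchanges *)

Section ThreeSteps.
Local Open Scope nat_scope.
Local Open Scope group_scope.
Variables (I J : finType).
Implicit Types (f g : J -> I) (s : {perm I}) (T : {set I}).

(** A cyclic exchange: in each cluster of the cycle, one item (those of [M]) is
    handed to the next cluster. *)
Definition step f g : Prop := exists (M : {set J}) (t : {perm I}),
  [/\ {in M &, injective f}, cycle_on t (f @: M),
      forall j, j \in M -> g j = t (f j) & forall j, j \notin M -> g j = f j].

Lemma step_refl f : step f f.
Proof.
exists set0, 1; split=> [j k||j|] //; rewrite ?inE // imset0.
by split=> [|B _]; [apply: perm_on1 | left; apply: sub0set].
Qed.

Lemma card_fibre_step f g x : step f g -> #|fibre g x| = #|fibre f x|.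
Proof.
case=> M [t [injM [on_t _] gM goff]].
have fibreM (u : {perm I}) : perm_on (f @: M) u ->
    #|[set j in M | u (f j) == x]| = (x \in f @: M).
  move=> on_u; case: (boolP (x \in f @: M)) => xM; last first.
    apply: eq_card0 => j; rewrite !inE; apply/andP => -[jM /eqP ux].
    by case/negP: xM; rewrite -ux (perm_closed _ on_u) imset_f.
  have : u^-1 x \in f @: M by rewrite -(perm_closed _ on_u) permKV.
  case/imsetP=> k kM uk; transitivity #|[set k]|; last by rewrite cards1.
  apply: eq_card => j; rewrite !inE.
  apply/andP/eqP => [[jM /eqP ux]|->]; last by rewrite -uk permKV.
  by apply: injM; rewrite // -uk -ux permK.
rewrite -(cardsID M (fibre g x)) -(cardsID M (fibre f x)); congr (_ + _)%N.
  have -> : fibre g x :&: M = [set j in M | t (f j) == x].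
    by apply/setP => j; rewrite !inE andbC; case jM: (j \in M); rewrite //= gM.
  have -> : fibre f x :&: M = [set j in M | (1 : {perm I}) (f j) == x].
    by apply/setP => j; rewrite !inE perm1 andbC.
  by rewrite !fibreM // perm_on1.
by apply: eq_card => j; rewrite !inE; case: (boolP (j \in M)) => //= /goff->.
Qed.

(** Multiplying by a cycle through [T] merges all nontrivial orbits, and its
    inverse is again such a cycle. *)
Lemma factor_after s T : transversal_of s T ->
  exists r c, [/\ cycle_on r T, cycle_on c (moved s) & forall x, c (r x) = s x].
Proof.
case/transversal_cycle=> t [cyc_t cyc_ts]; exists t^-1, (t * s).
by split=> // [|x]; [apply: cycle_onV | rewrite permM permKV].
Qed.

Lemma factor_before s T : transversal_of s T ->
  exists r c, [/\ cycle_on r T, cycle_on c (moved s) & forall x, r (c x) = s x].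
Proof.
move/transversal_of_inv/transversal_cycle=> [t [cyc_t cyc_ts]].
exists t, (t * s^-1)^-1; split=> // [|x]; last by rewrite invMg invgK permM permKV.
by rewrite -(movedV s); apply: cycle_onV.
Qed.

(** The situation of the Birkhoff polytope, where at most one item leaves each
    cluster. *)
Lemma two_steps f g s (M : {set J}) :
    {in M &, injective f} -> f @: M = moved s ->
    (forall j, j \in M -> g j = s (f j)) ->
    (forall j, j \notin M -> g j = f j) ->
  exists f1, step f f1 /\ step f1 g.
Proof.
move=> injM fM gM goff; have [T trT] := transversal_exists s.
have [sT _ _] := trT.
have [r [c [cyc_r cyc_c rc]]] := factor_before trT.
exists (fun j => if j \in M then c (f j) else f j); split.
  exists M, c; rewrite fM; split=> // j; first by move->.
  by move/negPf->.
set f1 := fun j => _; exists [set j in M | c (f j) \in T], r.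
have f1M : f1 @: [set j in M | c (f j) \in T] = T.
  apply/setP => x; apply/imsetP/idP => [[j]|xT].
    by rewrite inE => /andP[jM jT] ->; rewrite /f1 jM.
  have : c^-1 x \in f @: M.
    by rewrite fM -(perm_closed _ cyc_c.1) permKV (subsetP sT).
  case/imsetP=> j jM cj; exists j; rewrite /f1 ?inE jM -cj permKV //.
rewrite f1M; split=> //.
- move=> j k; rewrite !inE /f1 => /andP[jM _] /andP[kM _]; rewrite jM kM.
  by move/perm_inj/injM; apply.
- by move=> j; rewrite inE /f1 => /andP[jM _]; rewrite jM rc gM.
- move=> j; rewrite inE /f1; case: (boolP (j \in M)) => [jM|] /= jT.
    by rewrite gM // -rc (out_perm cyc_r.1).
  by move=> _; apply: goff.
Qed.

(** The intermediate assignments are [f1], where the items of the first class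
    have moved along [c1], and [g1], which is [g] before the exchange along [c3]
    of the second class - except that the two items with target [a] have swapped
    their roles: the one of the second class, coming from [b], is already in [a],
    and the one of the first class waits in [t b] to be carried to [a]. *)
Lemma three_steps_overlap f g lam pi a : splitting f g lam pi ->
    a \in moved (pi true) -> a \in moved (pi false) ->
  exists f1 g1, [/\ step f f1, step f1 g1 & step g1 g].
Proof.
move=> [arc inj_lam item] a1 a2.
set s1 := pi true in a1 *; set s2 := pi false in a2 *.
pose b := s2^-1 a; have s2b : s2 b = a by rewrite permKV.
have b2 : b \in moved s2 by rewrite -(stable_mem _ (@stable_moved _ s2)) s2b.
have [T1 [T2 [tr1 tr2 aT1 bT2 disT]]] := disjoint_transversals a1 b2 s2b.
have [r [c1 [cyc_r cyc_c1 rc1]]] := factor_before tr1.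
have [t [c3 [cyc_t cyc_c3 c3t]]] := factor_after tr2.
have [sT1 _ _] := tr1; have [sT2 _ _] := tr2.
(* After the first exchange, [u] holds the item of the first class with
   target [a]; the transposition of [u] and [b] swaps the two roles. *)
pose u := r^-1 a; have ru : r u = a by rewrite permKV.
have uT1 : u \in T1 by rewrite -(perm_closed _ cyc_r.1) ru.
have cyc_q := merged_cycle cyc_r cyc_t disT uT1 bT2.
set q := tperm u b * (r * t) in cyc_q.
have bT1 : b \notin T1 by rewrite (disjointFl disT).
have aT2 : a \notin T2 by rewrite (disjointFr disT).
have qu : q u = t b by rewrite !permM tpermL (out_perm cyc_r.1).
have qb : q b = a by rewrite !permM tpermR ru (out_perm cyc_t.1).
have q1 x : x \in T1 -> x != u -> q x = r x.
  move=> xT1 xu; rewrite !permM tpermD 1?eq_sym //; last by apply: contraNneq bT1 => <-.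
  by rewrite (out_perm cyc_t.1) // (disjointFr disT) // (perm_closed _ cyc_r.1).
have q2 x : x \in T2 -> x != b -> q x = t x.
  move=> xT2 xb; have xT1 : x \notin T1 by rewrite (disjointFl disT).
  rewrite !permM tpermD 1?eq_sym //; last by apply: contraNneq xT1 => ->.
  by rewrite (out_perm cyc_r.1).
have arc1 j : lam j -> g j = r (c1 (f j)) by move=> lj; rewrite arc lj -/s1 rc1.
have arc2 j : ~~ lam j -> g j = c3 (t (f j)).
  by move=> lj; rewrite arc (negPf lj) -/s2 c3t.
have ga j : lam j -> (g j == a) = (c1 (f j) == u).
  by move=> lj; rewrite arc1 // -ru (inj_eq perm_inj).
have item1 x : x \in moved s1 -> exists2 j, lam j & f j = x by apply: item.
have item2 x : x \in moved s2 -> exists2 j, ~~ lam j & f j = x.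
  by case/item=> j lj fj; exists j; rewrite ?lj.
pose f1 j := if lam j then c1 (f j) else f j.
pose g1 j := if lam j then if g j == a then t b else g j
             else if f j == b then a else t (f j).
exists f1, g1; split.
- exists [set j | lam j && (f j \in moved s1)], c1.
  have -> : f @: [set j | lam j && (f j \in moved s1)] = moved s1.
    apply/setP => x; apply/imsetP/idP => [[j]|xs].
      by rewrite inE => /andP[_ ?] ->.
    by have [j lj fj] := item1 x xs; exists j; rewrite // inE lj fj.
  split=> // [j k|j|j].
  + by rewrite !inE => /andP[lj _] /andP[lk _]; apply: inj_lam; rewrite lj lk.
  + by rewrite /f1 inE => /andP[->].
  + rewrite /f1 inE; case: ifP => //= lj ns.
    by rewrite (out_perm cyc_c1.1).
- exists [set j | f1 j \in if lam j then T1 else T2], q.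
  have -> : f1 @: [set j | f1 j \in if lam j then T1 else T2] = T1 :|: T2.
    apply/setP => x; apply/imsetP/idP => [[j]|].
      by rewrite !inE => + ->; case: ifP => _ ->; rewrite ?orbT.
    case/setUP=> xT.
      have : c1^-1 x \in moved s1.
        by rewrite -(perm_closed _ cyc_c1.1) permKV (subsetP sT1).
      by case/item1=> j lj fj; exists j; rewrite ?inE /f1 lj fj permKV.
    have [j lj fj] := item2 x (subsetP sT2 x xT).
    by exists j; rewrite ?inE /f1 (negPf lj) fj.
  split=> // [j k|j|j]; rewrite !inE.
  + rewrite /f1; case: (boolP (lam j)) => lj; case: (boolP (lam k)) => lk jT kT.
    * by move/perm_inj; apply: inj_lam; rewrite lj lk.
    * by move=> e; move: kT; rewrite -e (disjointFr disT jT).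
    * by move=> e; move: jT; rewrite e (disjointFr disT kT).
    * by apply: inj_lam; rewrite (negPf lj) (negPf lk).
  + rewrite /f1 /g1; case: ifP => lj jT.
      rewrite ga //; case: eqVneq => [->|ju]; first by rewrite qu.
      by rewrite q1 // arc1.
    by case: eqVneq => [->|jb]; rewrite ?qb // q2.
  + rewrite /f1 /g1; case: ifP => lj jT.
      rewrite ga // arc1 // (out_perm cyc_r.1) //.
      by case: eqVneq => // ju; rewrite ju uT1 in jT.
    rewrite (out_perm cyc_t.1) //.
    by case: eqVneq => // jb; rewrite jb bT2 in jT.
-
  (* The item from [b] is already in [a], so the one waiting in [t b] moves in its
     place. *)
  pose M := [set j | if lam j then g j == a else (f j \in moved s2) && (f j != b)].
  have g1M : g1 @: M = moved s2.
    apply/setP => x; apply/imsetP/idP => [[j]|xs].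
      rewrite inE /g1; case: ifP => _.
        by move=> ja ->; rewrite ja -(perm_closed _ cyc_c3.1) c3t s2b.
      case/andP=> fj /negPf jb ->; rewrite jb.
      by rewrite -(perm_closed _ cyc_c3.1) c3t stable_moved.
    have [->|xtb] := eqVneq x (t b).
      have : s1^-1 a \in moved s1.
        by rewrite -(stable_mem _ (@stable_moved _ s1)) permKV.
      case/item1=> j lj fj; have gj : g j = a by rewrite arc lj -/s1 fj permKV.
      by exists j; rewrite ?inE /g1 lj gj eqxx.
    have txs : t^-1 x \in moved s2.
      rewrite -(stable_mem _ (@stable_moved _ s2)) -c3t permKV.
      by rewrite (perm_closed _ cyc_c3.1).
    have [j lj fj] := item2 _ txs; have jb : f j != b.
      by apply: contraNneq xtb => <-; rewrite fj permKV.
    exists j; first by rewrite in_set (negPf lj) jb fj txs.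
    by rewrite /g1 (negPf lj) (negPf jb) fj permKV.
  exists M, c3; rewrite g1M; split=> // [j k|j|j]; rewrite !inE /g1.
  + case: (boolP (lam j)) => lj; case: (boolP (lam k)) => lk.
    * rewrite ga // ga // => /eqP ej /eqP ek _; apply: inj_lam; first by rewrite lj lk.
      by apply: (@perm_inj _ c1); rewrite ej ek.
    * by move=> -> /andP[_ kb]; rewrite (negPf kb) => /perm_inj e; rewrite -e eqxx in kb.
    * by move=> /andP[_ jb] ->; rewrite (negPf jb) => /perm_inj e; rewrite e eqxx in jb.
    * move=> /andP[_ /negPf->] /andP[_ /negPf->] /perm_inj.
      by apply: inj_lam; rewrite (negPf lj) (negPf lk).
  + case: ifP => lj; first by move=> ja; rewrite ja c3t s2b; apply/eqP.
    by case/andP=> _ /negPf->; rewrite arc2 // lj.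
  + case: ifP => lj; first by move/negPf->.
    case: (eqVneq (f j) b) => [jb _|jb]; first by rewrite arc2 ?lj // jb c3t.
    rewrite andbT negbK => /eqP s2j; rewrite arc2 ?lj // c3t s2j.
    by rewrite (out_perm (subset_trans cyc_t.1 sT2)) // inE s2j eqxx.
Qed.

(** If no cluster is moved by both permutations, at most one item leaves each
    cluster, and [two_steps] applies to the product. *)
Theorem three_steps (x0 : I) f g :
    (forall x, #|fibre f x| = #|fibre g x|) -> (forall x, #|fibre f x| <= 2) ->
  exists f1 g1, [/\ step f f1, step f1 g1 & step g1 g].
Proof.
move=> fib le2; have [lam [pi spl]] := splitting_exists x0 fib le2.
have [disS|] := boolP [disjoint moved (pi true) & moved (pi false)]; last first.
  by case/pred0Pn=> a /andP[]; apply: three_steps_overlap spl.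
have [arc inj_lam item] := spl.
have stay b x : x \in moved (pi b) -> pi (~~ b) x = x.
  move=> xb; apply/eqP; rewrite -[_ == x]negbK; apply/negP => xb'.
  have {}xb' : x \in moved (pi (~~ b)) by rewrite inE.
  by case: b xb xb' => xb; rewrite ?(disjointFr disS xb) ?(disjointFl disS xb).
have moved_arc j : g j != f j -> f j \in moved (pi (lam j)) by rewrite arc inE.
have sE b x : x \in moved (pi b) -> (pi true * pi false) x = pi b x.
  move=> xb; rewrite permM; case: b xb => xb; last by rewrite (stay _ _ xb).
  by rewrite (stay true) // (@stable_moved _ (pi true)).
have [|||j|f1 [st1 st2]] :=
    @two_steps f g (pi true * pi false) [set j | g j != f j].
- move=> j k; rewrite !inE => /moved_arc js /moved_arc ks fjk.
  apply: inj_lam => //; move: js ks; rewrite fjk.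
  case: (lam j); case: (lam k) => // js ks.
    by rewrite (disjointFr disS js) in ks.
  by rewrite (disjointFl disS js) in ks.
- apply/setP => x; apply/imsetP/idP => [[j]|].
    rewrite inE => /moved_arc js ->; rewrite inE (sE _ _ js).
    by rewrite inE in js.
  rewrite inE permM => xs.
  have [b xb] : exists b, x \in moved (pi b).
    have [s1x|s1x] := eqVneq (pi true x) x; last by exists true; rewrite inE.
    by exists false; rewrite inE -{1}s1x.
  have [j lj fj] := item b x xb; exists j => //.
  by rewrite inE arc lj fj; rewrite inE in xb.
- by move=> j; rewrite inE => /moved_arc/sE->.
- by rewrite inE negbK => /eqP.
by exists f1, g; split=> //; apply: step_refl.
Qed.
End ThreeSteps.

(** * Vertices and edges of the partition polytope *)

Section Polytope.
Local Open Scope ring_scope.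
Variables (R : realFieldType) (n : nat) (kappa : 'I_n -> nat).
Local Notation m := (\sum_i kappa i)%N.
Local Notation P := (partition_polytope R kappa).
Implicit Types (f g : 'I_m -> 'I_n) (y : 'M[R]_(n, m)).

Definition balanced f := forall i, #|fibre f i| = kappa i.

Definition assignment_mx f : 'M[R]_(n, m) := \matrix_(i, j) (f j == i)%:R.

Lemma balanced_slots : balanced (@tagnat.sig1 n kappa).
Proof.
move=> i; rewrite -[RHS]card_ord.
have injR : injective (@tagnat.Rank n kappa i).
  move=> k l /(congr1 val)/= /eqP; rewrite tagnat.eq_Rank => /andP[_ /eqP].
  exact: val_inj.
rewrite -(card_imset predT injR); apply: eq_card => j; rewrite inE.
apply/eqP/imsetP => [<-|[k _ ->]]; last exact: tagnat.Rank1K.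
by exists (tagnat.sig2 j); rewrite // tagnat.sig2K.
Qed.

Lemma assignment_mx_in f : balanced f -> P (assignment_mx f).
Proof.
move=> bal; split=> [i|j|i j].
- transitivity (\sum_j (f j == i)%:R : R).
    by apply: eq_bigr => j _; rewrite mxE.
  rewrite -natr_sum; congr _%:R; transitivity #|fibre f i|; last exact: bal.
  by rewrite -sum1_card [RHS]big_mkcond; apply: eq_bigr => j _; rewrite inE; case: eqP.
- rewrite (bigD1 (f j)) //= mxE eqxx [X in _ + X]big1 ?addr0 // => i.
  by rewrite mxE eq_sym => /negPf->.
- by rewrite mxE ler0n.
Qed.

Definition pairing (W y : 'M[R]_(n, m)) : R^o := \sum_i \sum_j W i j * y i j.

Fact pairing_is_linear W : linear (pairing W).
Proof.
move=> a x y; rewrite /pairing scaler_sumr -big_split; apply: eq_bigr => i _.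
rewrite scaler_sumr -big_split; apply: eq_bigr => j _ /=.
by rewrite !mxE mulrDr /GRing.scale /= mulrCA.
Qed.
HB.instance Definition _ W :=
  GRing.isLinear.Build R _ _ _ (pairing W) (pairing_is_linear W).

Lemma total_mass y : P y -> \sum_i \sum_j y i j = m%:R.
Proof.
by case=> rows _ _; rewrite natr_sum; apply: eq_bigr => i _; rewrite rows.
Qed.

(** The face is cut out by the sum of the entries in [S]: on the polytope this is
    the total mass minus the entries outside of [S], hence at most the total mass,
    with equality if and only if these entries vanish. *)
Lemma support_face (S : 'I_n -> 'I_m -> bool) y0 :
    P y0 -> (forall i j, ~~ S i j -> y0 i j = 0) ->
  face P [set y | P y /\ forall i j, ~~ S i j -> y i j = 0]%classic.
Proof.
move=> Py0 Sy0; split; first by exists y0.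
pose W : 'M[R]_(n, m) := \matrix_(i, j) (S i j)%:R.
pose off y := \sum_i \sum_j (~~ S i j)%:R * y i j.
have split_mass y : P y -> pairing W y + off y = m%:R.
  move=> Py; rewrite -(total_mass Py) /pairing /off -big_split; apply: eq_bigr => i _.
  rewrite -big_split; apply: eq_bigr => j _; rewrite /= mxE.
  by case: (S i j); rewrite mul1r mul0r ?addr0 ?add0r.
have term_ge0 y i j : P y -> 0 <= (~~ S i j)%:R * y i j.
  by case=> _ _ y0'; rewrite mulr_ge0 ?ler0n.
have off_ge0 y : P y -> 0 <= off y.
  by move=> Py; apply: sumr_ge0 => i _; apply: sumr_ge0 => j _; apply: term_ge0.
exists (linfun (pairing W)), m%:R; split=> [y Py|].
  by rewrite lfunE /= -(split_mass y Py) lerDl off_ge0.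
apply/seteqP; split=> y [Py]; rewrite /= lfunE /=.
  move=> Sy; split=> //; rewrite -(split_mass y Py) [off y]big1 ?addr0 // => i _.
  by apply: big1 => j _; case: (boolP (S i j)) => [|/Sy->]; rewrite ?mulr0 ?mul0r.
move=> eqm; split=> // i j Sij.
have /eqP : off y = 0 by apply: (addrI (pairing W y)); rewrite split_mass // addr0.
rewrite psumr_eq0 => [|i' _]; last by apply: sumr_ge0 => j' _; apply: term_ge0.
move/allP/(_ i (mem_index_enum i)).
rewrite psumr_eq0 => [|j' _]; last exact: term_ge0.
by move/allP/(_ j (mem_index_enum j)); rewrite Sij mul1r => /eqP.
Qed.

Lemma vertex_assignment f : balanced f -> vertex P (assignment_mx f).
Proof.
move=> bal; rewrite /vertex /=.
have := @support_face (fun i j => f j == i) _ (assignment_mx_in bal).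
have -> : [set y | P y /\ forall i j, f j != i -> y i j = 0]%classic
    = [set assignment_mx f]%classic.
  apply/seteqP; split=> y /=; last first.
    by move->; split=> [|i j]; [exact: assignment_mx_in | rewrite mxE => /negPf->].
  case=> -[_ cols _] off; apply/matrixP => i j; rewrite mxE.
  case: eqP => [<-|/eqP]; last exact: off.
  have := cols j; rewrite (bigD1 (f j)) //= [X in _ + X]big1 ?addr0 // => i'.
  by rewrite eq_sym; apply: off.
by apply=> i j; rewrite mxE => /negPf->.
Qed.


(** Hall's condition for matching the items to the slots of the clusters: the
    columns in [T] carry mass [#|T|], all of it in the rows that meet the support
    of these columns, and these rows have as much mass as slots. *)
Lemma assignment_in_support y : P y ->
  exists2 f, balanced f & forall j, 0 < y (f j) j.
Proof.
move=> [rows cols y_ge0].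
have [j0|no_item] := pickP (fun _ : 'I_m => true); last first.
  exists (@tagnat.sig1 n kappa); first exact: balanced_slots.
  by move=> j; have := no_item j.
move=> _; pose sig1 := @tagnat.sig1 n kappa.
have hallP : hall_condition (fun j k => 0 < y (sig1 k) j) [set: 'I_m].
  move=> T _; set N := neighbours _ T.
  pose I0 := [set i | [exists j in T, 0 < y i j]].
  have cardN : #|N| = (\sum_(i in I0) kappa i)%N.
    rewrite -sum1_card (partition_big sig1 (mem I0)) /=; last first.
      move=> k /neighboursP[j jT ykj]; rewrite inE.
      by apply/exists_inP; exists j.
    apply: eq_bigr => i; rewrite inE => /exists_inP[j jT yij].
    rewrite -balanced_slots -sum1_card; apply: eq_bigl => k; rewrite [RHS]inE.
    case: eqP => [ki|]; rewrite ?andbF // andbT.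
    by apply/neighboursP; exists j; rewrite ?ki.
  rewrite -(@ler_nat R) cardN natr_sum.
  have -> : #|T|%:R = \sum_(j in T) \sum_(i in I0) y i j :> R.
    rewrite -sum1_card natr_sum; apply: eq_bigr => j jT; rewrite -(cols j).
    rewrite (bigID (mem I0)) /= [X in _ + X]big1 ?addr0 // => i iI0.
    apply/eqP; rewrite eq_le y_ge0 andbT leNgt; apply: contra iI0 => yij.
    by rewrite inE; apply/exists_inP; exists j.
  rewrite exchange_big /=; apply: ler_sum => i _; rewrite -(rows i).
  rewrite [leRHS](bigID (mem T)) /= lerDl; apply: sumr_ge0 => j _; exact: y_ge0.
have [h [injh hP]] := hall j0 hallP.
exists (sig1 \o h) => [i|j]; last by apply: hP; rewrite inE.
rewrite -(balanced_slots i) -(@card_preimset _ h (fibre sig1 i)); last first.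
  by move=> j k; apply: injh; rewrite inE.
by apply: eq_card => j; rewrite !inE.
Qed.

(** With [f] in the support of [y], the point [y] lies between [assignment_mx f]
    and [y + e *: (y - assignment_mx f)], which is still in the polytope for
    small [e].  Any face through [y] contains both, so a face that is a single
    point forces them to agree. *)
Lemma vertex_integral y : vertex P y ->
  exists2 f, balanced f & y = assignment_mx f.
Proof.
case=> _ [c [b [le_b eqF]]].
have [Py cy] : P y /\ c y = b by have : [set y]%classic y by []; rewrite eqF.
have [f bal f_pos] := assignment_in_support Py; exists f => //.
(* Only the entries at [f] decrease, and by at most [e]. *)
pose e : R := \big[Num.min/1]_j y (f j) j.
have e_gt0 : 0 < e.
  by apply: (big_ind (fun z => 0 < z)) => // a a' a0 a'0; rewrite lt_min a0.
have e_le j : e <= y (f j) j by apply: bigmin_le_cond.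
have Pf := assignment_mx_in bal.
have Pz : P (y + e *: (y - assignment_mx f)).
  have [rows cols y_ge0] := Py; have [rowsf colsf _] := Pf.
  split=> [i|j|i j].
  - transitivity (\sum_j y i j + e * (\sum_j y i j - \sum_j assignment_mx f i j)).
      rewrite -sumrB mulr_sumr -big_split; apply: eq_bigr => j _.
      by rewrite /= 4!mxE.
    by rewrite rows rowsf subrr mulr0 addr0.
  - transitivity (\sum_i y i j + e * (\sum_i y i j - \sum_i assignment_mx f i j)).
      rewrite -sumrB mulr_sumr -big_split; apply: eq_bigr => i _.
      by rewrite /= 4!mxE.
    by rewrite cols colsf subrr mulr0 addr0.
  - rewrite 5!mxE; case: eqP => [<-|_]; last first.
      by rewrite subr0 addr_ge0 ?mulr_ge0 ?(ltW e_gt0).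
    rewrite mulrBr mulr1 addrCA addr_ge0 ?mulr_ge0 ?(ltW e_gt0) //.
    by rewrite subr_ge0.
have cf : c (assignment_mx f) = b.
  apply/eqP; rewrite eq_le le_b //=.
  have := le_b _ Pz; rewrite linearD linearZ linearB /= cy.
  rewrite gerDl /GRing.scale /= pmulr_rle0 // subr_le0 //.
suff : [set y]%classic (assignment_mx f) by [].
by rewrite eqF.
Qed.

Lemma step_balanced f g : step f g -> balanced f -> balanced g.
Proof. by move=> st bal i; rewrite (card_fibre_step i st). Qed.

(** In each column, a point supported by [f] and [g] has one degree of freedom,
    the fraction [y (g j) j] of the item [j] that has moved. *)
Lemma entry_on_edge f g y i j :
    P y -> (forall i j, ~~ ((f j == i) || (g j == i)) -> y i j = 0) ->
  y i j - (f j == i)%:R = y (g j) j * ((g j == i)%:R - (f j == i)%:R).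
Proof.
move=> [_ cols _] offy.
have := cols j; rewrite (bigD1 (g j)) //=.
have [eqfg|neqfg] := eqVneq (f j) (g j).
  rewrite [X in _ + X]big1 ?addr0 => [yg|i' i'g]; last first.
    by apply: offy; rewrite eqfg orbb eq_sym.
  rewrite eqfg subrr mulr0; case: eqVneq => [<-|gi]; first by rewrite yg subrr.
  by rewrite subr0; apply: offy; rewrite eqfg orbb.
rewrite [X in _ + X](bigD1 (f j)) //=.
rewrite [X in _ + (_ + X)]big1 ?addr0 => [yfg|i' /andP[i'g i'f]].
  case: (eqVneq (g j) i) => [<-|gi].
    by rewrite (negPf neqfg) !subr0 mulr1.
  case: (eqVneq (f j) i) => [<-|fi].
    by rewrite sub0r mulrN1 -yfg opprD addrCA subrr addr0.
  by rewrite !subr0 mulr0; apply: offy; rewrite negb_or fi.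
by apply: offy; rewrite negb_or ![_ == i']eq_sym i'g i'f.
Qed.

(** The row sums make the moved fraction a conserved flow on the clusters: what
    enters a cluster leaves it.  As the moved items form one cycle, the fraction
    is the same for all of them. *)
Lemma edge_line f g y : balanced f -> step f g ->
    P y -> (forall i j, ~~ ((f j == i) || (g j == i)) -> y i j = 0) ->
  exists d : R, y - assignment_mx f = d *: (assignment_mx g - assignment_mx f).
Proof.
move=> bal [M [t [injM [on_t indec] gM goff]]] Py offy.
have entry i j := @entry_on_edge f g y i j Py offy.
pose flow j := y (g j) j.
have conserved i : \sum_(j in M) flow j * (g j == i)%:R
    = \sum_(j in M) flow j * (f j == i)%:R.
  have : \sum_j flow j * ((g j == i)%:R - (f j == i)%:R) = 0.
    transitivity (\sum_j (y i j - assignment_mx f i j)).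
      by apply: eq_bigr => j _; rewrite mxE entry.
    have [rows _ _] := Py; have [rowsf _ _] := assignment_mx_in bal.
    by rewrite sumrB rows rowsf subrr.
  rewrite (bigID (mem M)) /= [X in _ + X]big1 ?addr0 => [|j /goff->]; last first.
    by rewrite subrr mulr0.
  move=> sum0; apply/eqP; rewrite -subr_eq0 -sumrB -[X in _ == X]sum0.
  by apply/eqP; apply: eq_bigr => j _; rewrite mulrBr.
have pick_one (u : 'I_m -> 'I_n) k : {in M &, injective u} -> k \in M ->
    \sum_(j in M) flow j * (u j == u k)%:R = flow k.
  move=> inju kM; rewrite (bigD1 k) //= eqxx mulr1 [X in _ + X]big1 ?addr0 //.
  move=> j /andP[jM jk]; case: eqP => [/(inju _ _ jM kM) ejk|_]; last by rewrite mulr0.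
  by rewrite ejk eqxx in jk.
have injgM : {in M &, injective g}.
  by move=> j k jM kM; rewrite !gM // => /perm_inj; apply: injM.
have [M0|[j0 j0M]] := set_0Vmem M.
  exists 0; apply/matrixP => i j.
  by rewrite 5!mxE entry goff ?M0 ?inE // subrr mulr0 mul0r.
(* Conservation makes the clusters that are left by this fraction invariant. *)
pose B := [set f j | j in M & flow j == flow j0].
have stB : stable t B.
  move=> x /imsetP[j]; rewrite inE => /andP[jM /eqP flow_j] ->.
  have : t (f j) \in f @: M by rewrite (perm_closed _ on_t) imset_f.
  case/imsetP=> k kM tjk; apply/imsetP; exists k; rewrite // inE kM /= -flow_j.
  rewrite -(pick_one f k) // -conserved -tjk -gM //.
  by rewrite pick_one.
have flow_const j : j \in M -> flow j = flow j0.
  have j0B : f j0 \in B by apply: imset_f; rewrite inE j0M eqxx.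
  case: (indec _ stB) => [sMB|disB]; last first.
    by have := disjointFl disB j0B; rewrite imset_f.
  move=> jM; have := subsetP sMB _ (imset_f f jM); case/imsetP=> k.
  by rewrite inE => /andP[kM /eqP<-] /(injM _ _ jM kM)->.
exists (flow j0); apply/matrixP => i j.
rewrite 5!mxE entry -/(flow j) 3!mxE; case: (boolP (j \in M)) => [/flow_const->//|jM].
by rewrite goff // subrr !mulr0.
Qed.

Lemma step_adjacent f g : balanced f -> step f g ->
  assignment_mx f = assignment_mx g
  \/ adjacent P (assignment_mx f) (assignment_mx g).
Proof.
move=> bal st; have balg := step_balanced st bal.
have [eqfg|neq] := eqVneq (assignment_mx f) (assignment_mx g); [by left | right].
split; [exact: vertex_assignment | exact: vertex_assignment | exact/eqP |].
pose S i j := (f j == i) || (g j == i).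
exists [set y | P y /\ forall i j, ~~ S i j -> y i j = 0]%classic.
have offf i j : ~~ S i j -> assignment_mx f i j = 0.
  by rewrite mxE => /norP[/negPf->].
have offg i j : ~~ S i j -> assignment_mx g i j = 0.
  by rewrite mxE => /norP[_ /negPf->].
have Pf := assignment_mx_in bal; have Pg := assignment_mx_in balg.
split=> //; first exact: support_face offf.
exists (assignment_mx f), [tuple assignment_mx g]; split=> //.
- by move=> x; rewrite inE => /eqP->.
- by rewrite seq1_free subr_eq0 eq_sym.
move=> y [Py offy]; rewrite /= span_seq1; apply/vlineP.
by have [d ->] := edge_line bal st Py offy; exists d.
Qed.
End Polytope.

(** * The diameter *)

Section Diameter.
Local Open Scope nat_scope.

Lemma walk_extend (V : Type) (e : V -> V -> Prop) k u v w :
  walk e k u v -> e v w -> walk e k.+1 u w.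
Proof.
case=> p [p0 pk pe] evw; exists (fun i => if i <= k then p i else w); split=> //.
  by rewrite ltnn.
move=> i; rewrite ltnS leq_eqVlt /= => /predU1P[->|ik]; last first.
  by rewrite ik orbT; apply: pe.
by rewrite eqxx ltnn pk.
Qed.

Lemma graph_diameter_exists (V : Type) (S : set V) (e : V -> V -> Prop) D :
    (exists v, S v) ->
    (forall v w, S v -> S w -> exists2 k, walk e k v w & k <= D) ->
  exists2 d, graph_diameter S e d & d <= D.
Proof.
move=> [v0 Sv0] walks.
have dists v w : S v -> S w -> exists2 k, graph_dist e v w k & k <= D.
  move=> Sv Sw; have [k0 wk0 k0D] := walks v w Sv Sw.
  have ex : exists k, `[< walk e k v w >] by exists k0; apply/asboolP.
  case: (ex_minnP ex) => k /asboolP wk min_k; exists k.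
    by split=> // j wj; apply: min_k; apply/asboolP.
  by apply: leq_trans k0D; apply: min_k; apply/asboolP.
pose attained d := `[< exists v w, [/\ S v, S w & graph_dist e v w d] >].
have [k0 d0 k0D] := dists v0 v0 Sv0 Sv0.
have ex : exists d, attained d by exists k0; apply/asboolP; exists v0, v0.
have unique v w k l : graph_dist e v w k -> graph_dist e v w l -> k = l.
  move=> [wk mink] [wl minl]; apply/eqP; rewrite eqn_leq mink //; exact: minl.
have bound d : attained d -> d <= D.
  case/asboolP=> v [w [Sv Sw dvw]]; have [k dk kD] := dists v w Sv Sw.
  by rewrite (unique _ _ _ _ dvw dk).
case: (ex_maxnP ex bound) => d ad max_d; exists d; last exact: bound.
split; first exact/asboolP.
move=> v w Sv Sw; have [k dk kD] := dists v w Sv Sw; exists k => //.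
by apply: max_d; apply/asboolP; exists v, w.
Qed.
End Diameter.

Theorem theorem1p2 (R : realType) (n : nat) (kappa : 'I_n.+1 -> nat)
    (kappa_noninc : forall i j : 'I_n.+1, (i <= j)%N -> (kappa j <= kappa i)%N)
    (kappa_first : kappa ord0 = 2%N) :
  exists2 d : nat,
    combinatorial_diameter (partition_polytope R kappa) d & (d <= 3)%N.
Proof.
have le2 i : (kappa i <= 2)%N by rewrite -kappa_first kappa_noninc.
apply: graph_diameter_exists.
  by eexists; apply: vertex_assignment; apply: balanced_slots.
move=> v w Sv Sw; have [f balf ->] := vertex_integral Sv.
have [g balg ->] := vertex_integral Sw.
have [f1 [g1 [st1 st2 st3]]] : exists f1 g1, [/\ step f f1, step f1 g1 & step g1 g].
  by apply: (three_steps ord0) => i; rewrite balf ?balg.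
have balf1 := step_balanced st1 balf; have balg1 := step_balanced st2 balf1.
have extend k u (h h' : 'I_(\sum_i kappa i) -> 'I_n.+1) : balanced h -> step h h' ->
    walk (adjacent (partition_polytope R kappa)) k u (assignment_mx R h) ->
  exists2 l, walk (adjacent (partition_polytope R kappa)) l u (assignment_mx R h')
    & (l <= k.+1)%N.
  move=> bal st wk; have [<-|adj] := step_adjacent R bal st; first by exists k.
  by exists k.+1; first exact: walk_extend adj.
have w0 : walk (adjacent (partition_polytope R kappa)) 0
    (assignment_mx R f) (assignment_mx R f) by exists (fun=> assignment_mx R f).
have [k1 w1 le1] := extend _ _ _ _ balf st1 w0.
have [k2 w2 le2'] := extend _ _ _ _ balf1 st2 w1.
have [k3 w3 le3] := extend _ _ _ _ balg1 st3 w2.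
exists k3 => //; apply: leq_trans le3 _; rewrite ltnS; apply: leq_trans le2' _.
by rewrite ltnS.
Qed.
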